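(* Let $B,\bar B$ be real or complex vector spaces and $L(\varepsilon)=\sum_{i=0}^\infty\varepsilon^iL_i$ a formal power series with $L_i\in L(B,\bar B)$, $L(\varepsilon)\not\equiv0$. Run the recursion of the context with some choice of complements. Then for every $k\ge0$ the following identities of operator row vectors (linear maps $B^{k+1}\to\bar B$) hold: $$(L_0\ \cdots\ L_k)\cdot M^{(k+1)}=(\bar S_1\ \cdots\ \bar S_{k+1})\cdot E^{(k+1)}=(S_1\ \cdots\ S_{k+1}).$$
   Context: $L(X,Y)$ denotes the linear maps from $X$ to $Y$; $I_X$ is the identity. Recursion. Put $N_0:=B$, $N_0^c:=\{0\}$, $R_0:=\{0\}$, $R_0^c:=\bar B$, $\bar S_1:=S_1:=L_0$, $E_{1,1}:=M_{1,1}:=I_B$. At each stage $j\ge1$, given $S_j\in L(B,R_{j-1}^c)$, set $N_j:=\{n\in N_{j-1}\mid S_jn=0\}$, $R_j:=S_j(N_{j-1})$ and choose algebraic direct complements $N_{j-1}=N_j^c\oplus N_j$, $R_{j-1}^c=R_j\oplus R_j^c$. Then $B=N_1^c\oplus\cdots\oplus N_j^c\oplus N_j$ and $\bar B=R_1\oplus\cdots\oplus R_j\oplus R_j^c$; $\mathcal P_j$ denotes the projection of $\bar B$ onto $R_j$ defined by the latter decomposition, and $S_j^{-1}:R_j\to N_j^c$ denotes the inverse of the bijection $S_j|_{N_j^c}:N_j^c\to R_j$. At stage $j\ge2$, the operators are defined by $$\bar S_j:=\sum_{i=1}^{j-1}L_iM_{i,j-1},\qquad S_j:=(I_{\bar B}-\mathcal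 P_1-\cdots-\mathcal P_{j-1})\bar S_j,$$ $$E_{j,j}:=I_B,\qquad E_{i,j}:=-S_i^{-1}\mathcal P_i\sum_{\nu=i+1}^{j}\bar S_\nu E_{\nu,j}\quad (i=j-1,\dots,1),$$ $$M_{1,j}:=E_{1,j},\qquad M_{i,j}:=\sum_{\nu=i}^{j}M_{i-1,\nu-1}E_{\nu,j}\quad(i=2,\dots,j).$$ (So $M_{j,j}=I_B$.) $E^{(k+1)}$ and $M^{(k+1)}$ are the upper triangular $(k+1)\times(k+1)$ operator matrices with entries $E_{i,j}$, respectively $M_{i,j}$, for $i\le j$ and $0$ for $i>j$. *)

(* Defs.v *)
From HB Require Import structures.
From mathcomp Require Import all_boot all_order all_algebra.
From mathcomp Require Import mathcomp_extra boolp classical_sets functions reals.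
From mathcomp Require Import complex.

Set Implicit Arguments.
Unset Strict Implicit.
Unset Printing Implicit Defensive.

Import Order.TTheory GRing.Theory Num.Theory.
Local Open Scope classical_set_scope.
Local Open Scope ring_scope.

Variant scalar_kind := RealScalars | ComplexScalars.

Definition scalars (R : realType) (s : scalar_kind) : fieldType :=
  match s with RealScalars => R | ComplexScalars => R[i] end.

Section Recursion.
Variables (K : fieldType).

(* Internal, purely algebraic direct sum U = A (+) C of linear subspaces. *)
Definition direct_sum (V : lmodType K) (U A C : set V) : Prop :=
  [/\ submod_closed (mem A), submod_closed (mem C),
      U = [set a + c | a in A & c in C]
    & A `&` C = [set 0]].

(* The component in W j of y along W 1 (+) ... (+) W j (+) C. *)
Definition component (V : lmodType K) (W : nat -> set V) (C : set V)
    (j : nat) (y : V) : V :=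
  xget 0 [set w | exists (x : nat -> V) (c : V),
    [/\ forall i, (1 <= i <= j)%N -> W i (x i),
        C c,
        y = \sum_(1 <= i < j.+1) x i + c
      & w = x j]].

Variables (B Bbar : lmodType K).

(* Operators are plain functions with pointwise addition; their linearity
   follows from [is_recursion] below. [Sbar] and [Sop] at index 0, and [Eop]
   and [Mop] outside 1 <= i <= j, are unconstrained and never used. *)
Record rec_data := RecData {
  Nsp  : nat -> set B;
  Ncpl : nat -> set B;
  Rsp  : nat -> set Bbar;
  Rcpl : nat -> set Bbar;
  Sbar : nat -> B -> Bbar;
  Sop  : nat -> B -> Bbar;
  Eop  : nat -> nat -> B -> B;
  Mop  : nat -> nat -> B -> B }.

Definition projR (D : rec_data) (j : nat) : Bbar -> Bbar :=
  component (Rsp D) (Rcpl D j) j.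

(* Inverse of the bijection Sop j : Ncpl j -> Rsp j; the value 0 taken outside
   Rsp j is irrelevant, as Sinv D j is only applied after projR D j. *)
Definition Sinv (D : rec_data) (j : nat) : Bbar -> B :=
  'pinv_(fun=> 0) (Ncpl D j) (Sop D j).

Record is_recursion (L : nat -> {linear B -> Bbar}) (D : rec_data) : Prop :=
  IsRecursion {
  rec_N0  : Nsp D 0 = [set: B];
  rec_Nc0 : Ncpl D 0 = [set 0];
  rec_R0  : Rsp D 0 = [set 0];
  rec_Rc0 : Rcpl D 0 = [set: Bbar];
  rec_Sbar1 : Sbar D 1 = L 0;
  rec_S1  : Sop D 1 = L 0;
  rec_E11 : Eop D 1 1 = id;
  rec_M11 : Mop D 1 1 = id;

  rec_N : forall j, (1 <= j)%N ->
    Nsp D j = [set n | Nsp D j.-1 n /\ Sop D j n = 0];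
  rec_R : forall j, (1 <= j)%N -> Rsp D j = Sop D j @` Nsp D j.-1;
  rec_Nc : forall j, (1 <= j)%N ->
    direct_sum (Nsp D j.-1) (Ncpl D j) (Nsp D j);
  rec_Rc : forall j, (1 <= j)%N ->
    direct_sum (Rcpl D j.-1) (Rsp D j) (Rcpl D j);

  rec_Sbar : forall j, (2 <= j)%N ->
    Sbar D j = \sum_(1 <= i < j) (L i \o Mop D i j.-1);
  rec_S : forall j, (2 <= j)%N ->
    Sop D j = (id - \sum_(1 <= i < j) projR D i) \o Sbar D j;
  rec_Ejj : forall j, (2 <= j)%N -> Eop D j j = id;
  rec_Eij : forall i j, (2 <= j)%N -> (1 <= i < j)%N ->
    Eop D i j = - (Sinv D i \o projR D i \o
                   \sum_(i.+1 <= nu < j.+1) (Sbar D nu \o Eop D nu j));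
  rec_M1j : forall j, (2 <= j)%N -> Mop D 1 j = Eop D 1 j;
  rec_Mij : forall i j, (2 <= j)%N -> (2 <= i <= j)%N ->
    Mop D i j = \sum_(i <= nu < j.+1) (Mop D i.-1 nu.-1 \o Eop D nu j) }.

(* Operator rows and matrices are matrices with entries in a function type;
   the ordinal indices 0 .. k stand for the indices 1 .. k+1 of A. *)
Definition upper_opmx (A : nat -> nat -> B -> B) (k : nat) :
    'M[B -> B]_k.+1 :=
  \matrix_(i, j) (if (i <= j)%N then A i.+1 j.+1 else 0).

Definition oprow_mul (m n : nat) (u : 'rV[B -> Bbar]_m)
    (A : 'M[B -> B]_(m, n)) : 'rV[B -> Bbar]_n :=
  \row_j \sum_i (u ord0 i \o A i j).

End Recursion.

(* Main.v *)
Require Import Defs.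
From HB Require Import structures.
From mathcomp Require Import all_boot all_order all_algebra.
From mathcomp Require Import mathcomp_extra boolp classical_sets functions reals.
From mathcomp Require Import complex.

Set Implicit Arguments.
Unset Strict Implicit.
Unset Printing Implicit Defensive.

Import Order.TTheory GRing.Theory Num.Theory.
Local Open Scope ring_scope.

(** Write [P l] for [projR D l] and [T i] for the tail
    [sum_(i <= nu <= j) Sbar nu \o E nu j].  The first identity is an exchange
    of summations.  For the second, [T j = Sbar j] and
    [T i = T i.+1 - Sbar i n] with [n = S_i^-1 (P i (T i.+1))].  Since
    [S i n = P i (T i.+1)], the vector [Sbar i n] is the sum of
    [P i (T i.+1)] and a vector of [R_1 + ... + R_(i-1)].  Passing from
    [T i.+1] to [T i] thus cancels the component in [R_i], creates none in
    [R_l] for [l > i], and leaves the component in [R_(j-1)^c] unchanged.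
    Hence [T 1] has no component in [R_1], ..., [R_(j-1)], and equals
    [(id - P 1 - ... - P (j-1)) (Sbar j) = S j]. *)

(** * Additive maps, as a predicate on plain functions *)

Section ZmodMorphism.
Context {U V : zmodType}.
Implicit Types f g : U -> V.

Lemma zmod_morphism0 f : zmod_morphism f -> f 0 = 0.
Proof. by move=> fB; rewrite -(subrr 0) fB subrr. Qed.

Lemma zmod_morphismN f : zmod_morphism f -> {morph f : x / - x}.
Proof. by move=> fB x; rewrite -sub0r fB zmod_morphism0 // sub0r. Qed.

Lemma zmod_morphismD f : zmod_morphism f -> {morph f : x y / x + y}.
Proof. by move=> fB x y; rewrite -[y in LHS]opprK fB zmod_morphismN // opprK. Qed.

Lemma zmod_morphism_sum f (I : Type) (r : seq I) (F : I -> U) :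
  zmod_morphism f -> f (\sum_(i <- r) F i) = \sum_(i <- r) f (F i).
Proof.
by move=> fB; apply: big_morph; [exact: zmod_morphismD | exact: zmod_morphism0].
Qed.

Lemma zmod_morphism_sum_fct m n (F : nat -> U -> V) :
  (forall i, (m <= i < n)%N -> zmod_morphism (F i)) ->
  zmod_morphism (\sum_(m <= i < n) F i).
Proof.
move=> FB x y; rewrite !fct_sumE -sumrB; apply: eq_big_nat => i i_mn.
exact: FB.
Qed.

End ZmodMorphism.

Lemma zmod_morphism_comp {U V W : zmodType} (f : V -> W) (g : U -> V) :
  zmod_morphism f -> zmod_morphism g -> zmod_morphism (f \o g).
Proof. by move=> fB gB x y; rewrite /= gB fB. Qed.

(** * Direct sums of two subspaces *)

Section DirectSum.
Local Open Scope classical_set_scope.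
Context {K : fieldType} {V : lmodType K}.
Implicit Types U A C : set V.

Lemma submod_closed_set0 A : submod_closed (mem A) -> A 0.
Proof. by case=> /set_mem. Qed.

Lemma submod_closed_setB A x y :
  submod_closed (mem A) -> A x -> A y -> A (x - y).
Proof.
move=> [_ AZ] Ax Ay; rewrite addrC -scaleN1r.
by apply: set_mem; apply: AZ; apply: mem_set.
Qed.

Lemma direct_sumP U A C u : direct_sum U A C -> U u ->
  exists a c, [/\ A a, C c & u = a + c].
Proof. by case=> _ _ -> _ [a Aa [c Cc <-]]; exists a, c. Qed.

Lemma direct_sumD U A C a c : direct_sum U A C -> A a -> C c -> U (a + c).
Proof. by case=> _ _ -> _ Aa Cc; exists a => //; exists c. Qed.

Lemma direct_sum_eq0 U A C x : direct_sum U A C -> A x -> C x -> x = 0.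
Proof.
by case=> _ _ _ AC0 Ax Cx; have : (A `&` C) x by []; rewrite AC0.
Qed.

Lemma direct_sum_uniq U A C a a' c c' : direct_sum U A C ->
  A a -> A a' -> C c -> C c' -> a + c = a' + c' -> a = a' /\ c = c'.
Proof.
move=> H Aa Aa' Cc Cc' E.
have [Am Cm _ _] := H.
have E' : a - a' = c' - c.
  by apply/eqP; rewrite subr_eq addrAC eq_sym subr_eq [c' + _]addrC E.
have a0 : a - a' = 0.
  apply: (direct_sum_eq0 H); first exact: submod_closed_setB.
  by rewrite E'; apply: submod_closed_setB.
split; apply/eqP; first by rewrite -subr_eq0 a0.
by rewrite eq_sym -subr_eq0 -E' a0.
Qed.

End DirectSum.

(** * Components along an iterated direct sum *)

Section Component.
Local Open Scope classical_set_scope.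
Context {K : fieldType} {V : lmodType K}.
Variables W C : nat -> set V.
Hypothesis C0 : C 0 = setT.
Hypothesis CW : forall j, (1 <= j)%N -> direct_sum (C j.-1) (W j) (C j).

Let CWS j : direct_sum (C j) (W j.+1) (C j.+1) := CW (ltn0Sn j).

Let W_submod j : (1 <= j)%N -> submod_closed (mem (W j)).
Proof. by move=> /CW[]. Qed.

Let C_submod j : (1 <= j)%N -> submod_closed (mem (C j)).
Proof. by move=> /CW[]. Qed.

Lemma iterated_sum_exists j y : exists x c,
  [/\ forall i, (1 <= i <= j)%N -> W i (x i), C j c
    & y = \sum_(1 <= i < j.+1) x i + c].
Proof.
elim: j => [|j [x [c [Wx Cc ->]]]].
  exists (fun=> 0), y; split=> [[]//||]; first by rewrite C0.
  by rewrite big_geq // add0r.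
have [a [c' [Wa Cc' ->]]] := direct_sumP (CWS j) Cc.
exists (fun i => if i == j.+1 then a else x i), c'; split=> //.
  move=> i /andP[i1]; rewrite leq_eqVlt; case: eqP => [->//|_ /= ij].
  by apply: Wx; rewrite i1.
rewrite [in RHS]big_nat_recr //= eqxx -addrA; congr (_ + _).
apply: eq_big_nat => i /andP[_ ij]; case: eqP => // ij1.
by rewrite ij1 ltnn in ij.
Qed.

(** Induction on [j]: the last term plus the remainder lies in [C j], so the shorter sums agree
    first, and uniqueness in [C j = W j.+1 (+) C j.+1] then separates the two. *)
Lemma iterated_sum_uniq j x x' c c' :
  (forall i, (1 <= i <= j)%N -> W i (x i)) ->
  (forall i, (1 <= i <= j)%N -> W i (x' i)) -> C j c -> C j c' ->
  \sum_(1 <= i < j.+1) x i + c = \sum_(1 <= i < j.+1) x' i + c' ->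
  c = c' /\ forall i, (1 <= i <= j)%N -> x i = x' i.
Proof.
elim: j c c' => [|j IH] c c' Wx Wx' Cc Cc'.
  by rewrite !big_geq // !add0r => ->; split=> // -[].
rewrite !(big_nat_recr j.+1) //= -!addrA => E.
have Wxj : W j.+1 (x j.+1) by apply: Wx; rewrite leqnn.
have Wxj' : W j.+1 (x' j.+1) by apply: Wx'; rewrite leqnn.
have [|||| E1 E2] := IH _ _ _ _ _ _ E.
- by move=> i /andP[i1 ij]; apply: Wx; rewrite i1 leqW.
- by move=> i /andP[i1 ij]; apply: Wx'; rewrite i1 leqW.
- exact: direct_sumD (CWS j) _ _.
- exact: direct_sumD (CWS j) _ _.
have [Ex Ec] := direct_sum_uniq (CWS j) Wxj Wxj' Cc Cc' E1.
split=> // i /andP[i1]; rewrite leq_eqVlt => /orP[/eqP->//|ij].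
by apply: E2; rewrite i1.
Qed.

(** A component taken at level [i] can be read off any longer decomposition, because the terms
    beyond [i] are absorbed into the remainder in [C i]. This lets projections of different levels
    act on one and the same decomposition. *)
Lemma component_sum j x c i : (1 <= i <= j)%N ->
  (forall l, (1 <= l <= j)%N -> W l (x l)) -> C j c ->
  component W (C i) i (\sum_(1 <= l < j.+1) x l + c) = x i.
Proof.
move=> /andP[i1]; elim: j c => [|j IH] c; first by case: i i1.
rewrite leq_eqVlt => /orP[/eqP->|ij] Wx Cc.
  apply: xget_unique; first by exists x, c.
  move=> _ [x' [c' [Wx' Cc' E ->]]].
  have [_ ->] := iterated_sum_uniq Wx Wx' Cc Cc' E => //.
  by rewrite leqnn.
rewrite big_nat_recr //= -addrA; apply: IH => //.
  by move=> l /andP[l1 lj]; apply: Wx; rewrite l1 leqW.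
by apply: direct_sumD (CWS j) _ Cc; apply: Wx; rewrite leqnn.
Qed.

Lemma component_mem j y : (1 <= j)%N -> W j (component W (C j) j y).
Proof.
move=> j1; have [x [c [Wx Cc ->]]] := iterated_sum_exists j y.
by rewrite component_sum ?j1 ?leqnn //; apply: Wx; rewrite j1 leqnn.
Qed.

Lemma component_zmod_morphism j : (1 <= j)%N ->
  zmod_morphism (component W (C j) j).
Proof.
move=> j1 y z.
have [x [c [Wx Cc ->]]] := iterated_sum_exists j y.
have [x' [c' [Wx' Cc' ->]]] := iterated_sum_exists j z.
rewrite !(component_sum (j := j)) ?j1 ?leqnn //.
rewrite opprD addrACA -sumrB component_sum ?j1 ?leqnn //.
  move=> l /[dup] /andP[l1 _] lj.
  by apply: submod_closed_setB; [exact: W_submod|exact: Wx|exact: Wx'].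
by apply: submod_closed_setB => //; exact: C_submod.
Qed.

Lemma component_id l m z : (1 <= l)%N -> (1 <= m)%N -> W m z ->
  component W (C l) l z = if l == m then z else 0.
Proof.
(* Padding [z] with zeros up to level [maxn l m] treats [l <= m] and [m <= l] at once. *)
move=> l1 m1 Wz; pose x i := if i == m then z else 0.
have lmx : (1 <= l <= maxn l m)%N by rewrite l1 leq_maxl.
have Ez : z = \sum_(1 <= i < (maxn l m).+1) x i + 0.
  rewrite addr0 -big_mkcond /= big_nat1_eq m1 ltnS leq_maxr //.
rewrite {1}Ez (component_sum (x := x) lmx) //.
  move=> i /andP[i1 _]; rewrite /x; case: eqP => [->//|_].
  by apply: submod_closed_set0; apply: W_submod.
by apply: submod_closed_set0; apply: C_submod; apply: leq_trans (leq_maxl _ _).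
Qed.

End Component.

(** * Projections and operators of the recursion *)

Section RecursionTheory.
Local Open Scope classical_set_scope.
Context {K : fieldType} {B Bbar : lmodType K}.
Variables (L : nat -> {linear B -> Bbar}) (D : rec_data B Bbar).
Hypothesis HD : is_recursion L D.

Lemma projR_mem j y : (1 <= j)%N -> Rsp D j (projR D j y).
Proof. exact: component_mem (rec_Rc0 HD) (rec_Rc HD) _ _. Qed.

Lemma projR_zmod_morphism j : (1 <= j)%N -> zmod_morphism (projR D j).
Proof. exact: component_zmod_morphism (rec_Rc0 HD) (rec_Rc HD) _. Qed.

Lemma projR_id l m z : (1 <= l)%N -> (1 <= m)%N -> Rsp D m z ->
  projR D l z = if l == m then z else 0.
Proof. by move=> l1 m1; apply: (component_id (rec_Rc HD)). Qed.

Lemma Sop_Sbar i x : (1 <= i)%N ->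
  Sop D i x = Sbar D i x - \sum_(1 <= l < i) projR D l (Sbar D i x).
Proof.
case: i => [//|[|i]] _.
  by rewrite (rec_S1 HD) (rec_Sbar1 HD) big_geq // subr0.
by rewrite (rec_S HD) //= !fctE fct_sumE.
Qed.

Lemma Eop_diag j : (1 <= j)%N -> Eop D j j = id.
Proof. by case: j => [//|[|j]] _; [exact: rec_E11 HD | exact: (rec_Ejj HD)]. Qed.

Lemma Mop_row1 j : (1 <= j)%N -> Mop D 1 j = Eop D 1 j.
Proof.
case: j => [//|[|j]] _; last exact: (rec_M1j HD).
by rewrite (rec_M11 HD) (rec_E11 HD).
Qed.

(** * The inverse of [Sop D i] on its range. Additivity of [Sop D i] is a hypothesis here, since
    these facts serve inside the induction that establishes it *)

Section SinvTheory.
Variable i : nat.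
Hypotheses (i1 : (1 <= i)%N) (SB : zmod_morphism (Sop D i)).

(** A preimage in [Nsp D i.-1] may be replaced by its part in [Ncpl D i]: the other part lies in the
    kernel [Nsp D i]. *)
Let Sop_surj : set_surj (Ncpl D i) (Rsp D i) (Sop D i).
Proof.
move=> r; rewrite (rec_R HD) // => -[n Nn <-].
have [a [c [Na Nc ->]]] := direct_sumP (rec_Nc HD i1) Nn.
exists a => //; move: Nc; rewrite (rec_N HD) // => -[_ Sc0].
by rewrite zmod_morphismD // Sc0 addr0.
Qed.

Lemma Sinv_mem r : Rsp D i r -> Ncpl D i (Sinv D i r).
Proof.
by move=> Rr; apply: (surjpinv_image_sub Sop_surj); exists r.
Qed.

Lemma SinvK r : Rsp D i r -> Sop D i (Sinv D i r) = r.
Proof. by move=> Rr; apply: (surjpK _ Sop_surj); rewrite inE. Qed.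

Lemma Ncpl_Sop_eq0 n : Ncpl D i n -> Sop D i n = 0 -> n = 0.
Proof.
move=> Nn Sn0; apply: (direct_sum_eq0 (rec_Nc HD i1)) => //.
rewrite (rec_N HD) //; split=> //; rewrite -[n]addr0.
apply: direct_sumD (rec_Nc HD i1) Nn _.
by apply: submod_closed_set0; case: (rec_Nc HD i1).
Qed.

(** Both sides lie in [Ncpl D i] and have the same image under [Sop D i], which is injective
    there. *)
Lemma SinvB r r' : Rsp D i r -> Rsp D i r' ->
  Sinv D i (r - r') = Sinv D i r - Sinv D i r'.
Proof.
move=> Rr Rr'; have [Nm _ _ _] := rec_Nc HD i1; have [Rm _ _ _] := rec_Rc HD i1.
have Rrr' := submod_closed_setB Rm Rr Rr'.
apply/eqP; rewrite -subr_eq0; apply/eqP; apply: Ncpl_Sop_eq0.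
  by do 2?apply: submod_closed_setB => //; apply: Sinv_mem.
by rewrite !SB !SinvK // subrr.
Qed.

End SinvTheory.

(** Strong induction on the stage, in the order of the recursion: [Sbar D j] from column [j.-1] of
    [Mop], then [Sop D j], then column [j] of [Eop] from the diagonal upwards, and finally column
    [j] of [Mop]. *)
Lemma operators_zmod_morphism j : (1 <= j)%N ->
  [/\ zmod_morphism (Sbar D j), zmod_morphism (Sop D j),
      forall i, (1 <= i <= j)%N -> zmod_morphism (Eop D i j)
    & forall i, (1 <= i <= j)%N -> zmod_morphism (Mop D i j)].
Proof.
elim/ltn_ind: j => j IH j1.
have SbarB : zmod_morphism (Sbar D j).
  case: j IH j1 => [//|[|j]] IH _; first by rewrite (rec_Sbar1 HD); exact: raddfB.
  rewrite (rec_Sbar HD) //; apply: zmod_morphism_sum_fct => i ij.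
  apply: zmod_morphism_comp; first exact: raddfB.
  by have [_ _ _] := IH j.+1 (ltnSn _) isT; apply.
have SopB : zmod_morphism (Sop D j).
  move=> x y; rewrite !Sop_Sbar // SbarB.
  rewrite (eq_big_nat _ _ (F2 := fun l => projR D l (Sbar D j x)
    - projR D l (Sbar D j y))); last first.
    by move=> l /andP[l1 _]; rewrite projR_zmod_morphism.
  by rewrite sumrB opprD addrACA -opprD.
have SbarSopB nu : (1 <= nu <= j)%N ->
    zmod_morphism (Sbar D nu) /\ zmod_morphism (Sop D nu).
  case/andP=> nu1; rewrite leq_eqVlt => /orP[/eqP->//|nuj].
  by have [] := IH nu nuj nu1.
have EopB i : (1 <= i <= j)%N -> zmod_morphism (Eop D i j).
  (* The induction is on a bound for [j - i], not on its value, because [Eop D i j] involves every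
     [Eop D nu j] with [i < nu <= j]. *)
  elim: {i}(j - i)%N {-2}i (leqnn (j - i)) => [|d IHd] i ji /andP[i1 ij].
    have -> : i = j by apply/eqP; rewrite eqn_leq ij -subn_eq0 -leqn0.
    by rewrite Eop_diag.
  move: (ij); rewrite leq_eqVlt => /orP[/eqP ->|iltj]; first by rewrite Eop_diag.
  rewrite (rec_Eij HD) ?i1 //; last exact: leq_ltn_trans i1 iltj.
  have TB : zmod_morphism (\sum_(i.+1 <= nu < j.+1) (Sbar D nu \o Eop D nu j)).
    apply: zmod_morphism_sum_fct => nu /andP[inu nuj].
    have nu1j : (1 <= nu <= j)%N by rewrite (leq_trans _ inu).
    apply: zmod_morphism_comp; first by case: (SbarSopB nu nu1j).
    apply: IHd => //; rewrite leq_subLR.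
    by apply: leq_trans (_ : i.+1 + d <= _)%N; rewrite ?leq_add2r // addSnnS -leq_subLR.
  have [_ SiB] := SbarSopB i (introT andP (conj i1 ij)).
  move=> x y; rewrite !fctE /= TB projR_zmod_morphism //.
  by rewrite SinvB //; [rewrite !opprD | exact: projR_mem | exact: projR_mem].
split=> // -[//|[|i]] ij; first by rewrite Mop_row1 //; exact: EopB.
rewrite (rec_Mij HD) //; last exact: leq_trans (_ : i.+2 <= j)%N.
apply: zmod_morphism_sum_fct => nu /andP[inu nuj].
apply: zmod_morphism_comp; last by apply: EopB; rewrite (leq_trans _ inu).
case: nu inu nuj => [//|nu] inu nuj.
have [|_ _ _] := IH nu nuj; first exact: (leq_trans (ltn0Sn i) inu).
by apply; rewrite /= -ltnS.
Qed.

(** * The two row identities, entry by entry *)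

Lemma sum_L_Mop j x :
  \sum_(1 <= i < j.+2) L i.-1 (Mop D i j.+1 x) =
  \sum_(1 <= i < j.+2) Sbar D i (Eop D i j.+1 x).
Proof.
rewrite big_ltn // [in RHS]big_ltn // Mop_row1 // (rec_Sbar1 HD); congr (_ + _).
(* Making [i <= nu] a condition on a fixed range allows the exchange of sums. For fixed [nu], the
   sum over [2 <= i <= nu] is then, after an index shift, the definition of [Sbar D nu]. *)
rewrite (eq_big_nat _ _ (F2 := fun i => \sum_(2 <= nu < j.+2 | (i <= nu)%N)
    L i.-1 (Mop D i.-1 nu.-1 (Eop D nu j.+1 x)))); last first.
  move=> i /andP[i2 ij]; rewrite (rec_Mij HD) ?i2 //; last exact: leq_trans i2 _.
  rewrite fct_sumE raddf_sum /= (big_nat_widenl _ 2) //.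
rewrite (exchange_big_dep_nat xpredT) //=; apply: eq_big_nat => nu /andP[nu2 nuj].
rewrite (rec_Sbar HD) // fct_sumE.
by rewrite -(big_nat_widen 2 nu.+1 j.+2 xpredT) //= big_add1.
Qed.

(** In [w = S_i n + P_1 w + ... + P_(i-1) w] each summand lies in a single [R_m] with [m <= i], so
    [projR_id] gives the components of [w] from [R_i] on. *)
Lemma projR_Sbar i n : (1 <= i)%N -> Rsp D i (Sop D i n) ->
  [/\ forall l, (i < l)%N -> projR D l (Sbar D i n) = 0,
      projR D i (Sbar D i n) = Sop D i n
    & Sbar D i n = \sum_(1 <= l < i.+1) projR D l (Sbar D i n)].
Proof.
move=> i1 RS; set w := Sbar D i n.
have Ew : w = Sop D i n + \sum_(1 <= m < i) projR D m w.
  by rewrite Sop_Sbar // subrK.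
have Pw l : (i <= l)%N -> projR D l w = if l == i then Sop D i n else 0.
  move=> il; have l1 := leq_trans i1 il.
  rewrite {1}Ew (zmod_morphismD (projR_zmod_morphism l1)).
  rewrite (zmod_morphism_sum _ _ (projR_zmod_morphism l1)) (projR_id l1 i1 RS).
  rewrite big_nat big1 ?addr0 // => m /andP[m1 mi].
  by rewrite (projR_id l1 m1 (projR_mem _ m1)) gtn_eqF // (leq_trans mi).
have Pi : projR D i w = Sop D i n by rewrite Pw // eqxx.
split=> // [l il|]; first by rewrite Pw ?gtn_eqF // ltnW.
by rewrite big_nat_recr //= Pi addrC.
Qed.

(** Descending induction on [i], starting from [T = Sbar D j x] at [i = j]. The second conjunct is
    the invariant that identifies the limit case [i = 1] with [Sop D j x]. *)
Lemma tail_sum_Sbar_Eop i j x : (1 <= i <= j)%N ->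
  let T := \sum_(i <= nu < j.+1) Sbar D nu (Eop D nu j x) in
  (forall l, (i <= l < j)%N -> projR D l T = 0) /\
  T - \sum_(1 <= l < j) projR D l T = Sop D j x.
Proof.
elim: {i}(j - i)%N {-2}i (erefl (j - i)%N) => [|d IH] i ji /andP[i1 ij] /=.
  have -> : i = j by apply/eqP; rewrite eqn_leq ij -subn_eq0 ji.
  rewrite big_nat1 Eop_diag ?(leq_trans i1) //; split=> [l|].
    by case/andP=> /leq_ltn_trans h /h; rewrite ltnn.
  by rewrite Sop_Sbar ?(leq_trans i1).
have iltj : (i < j)%N by rewrite -subn_gt0 ji.
have [SbarB SopB _ _] := operators_zmod_morphism i1.
rewrite big_ltn ?ltnS // (rec_Eij HD) ?i1 ?(leq_ltn_trans i1) //.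
rewrite !fctE fct_sumE /=.
(* The tail at [i] becomes [u - w], with [u] the tail at [i.+1] and [w] the image under [Sbar D i]
   of [n], which is minus the value of [Eop D i j] at [x]. *)
set u := \sum_(_ <= nu < _) _; rewrite (zmod_morphismN SbarB) addrC.
have ji' : (j - i.+1)%N = d by rewrite subnS ji.
have [/= Pu0 <-] := IH i.+1 ji' iltj.
rewrite -/u in Pu0 *; set n := Sinv D i _.
have Ru := projR_mem u i1.
have Sn : Sop D i n = projR D i u by apply: SinvK.
have [|Pw0 Pwi Ew] := @projR_Sbar i n i1; first by rewrite Sn.
set w := Sbar D i n in Pw0 Pwi Ew *.
have PB l : (1 <= l)%N -> projR D l (u - w) = projR D l u - projR D l w.
  by move=> l1; rewrite projR_zmod_morphism.
split=> [l /andP[il lj]|].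
  rewrite PB ?(leq_trans i1) //; move: il; rewrite leq_eqVlt => /orP[/eqP<-|il].
    by rewrite Pwi Sn subrr.
  by rewrite Pw0 // Pu0 ?il // subr0.
rewrite (eq_big_nat _ _ (F2 := fun l => projR D l u - projR D l w)); last first.
  by move=> l /andP[l1 _]; rewrite PB.
(* As [i < j], the first [j - 1] projections already recover all of [w]; subtracting [w] therefore
   leaves the invariant unchanged. *)
have Ewj : \sum_(1 <= l < j) projR D l w = w.
  rewrite (big_cat_nat _ iltj) //= -Ew big_nat big1 ?addr0 // => l /andP[il _].
  exact: Pw0.
by rewrite sumrB Ewj opprB addrA subrK.
Qed.

Lemma sum_Sbar_Eop j x : (1 <= j)%N ->
  \sum_(1 <= i < j.+1) Sbar D i (Eop D i j x) = Sop D j x.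
Proof.
move=> j1; have [|/= PT0 <-] := @tail_sum_Sbar_Eop 1 j x; first by rewrite j1.
by rewrite [X in _ - X]big_nat [X in _ - X]big1 ?subr0 // => l; apply: PT0.
Qed.

End RecursionTheory.

(** * From operator matrices to sums of values *)

Lemma oprow_mul_upperE {K : fieldType} {B Bbar : lmodType K} (k : nat)
    (F : nat -> B -> Bbar) (A : nat -> nat -> B -> B) (j : 'I_k.+1) x :
  (forall i, (1 <= i)%N -> F i 0 = 0) ->
  oprow_mul (\row_(i < k.+1) F i.+1) (upper_opmx A k) ord0 j x =
  \sum_(1 <= i < j.+2) F i (A i j.+1 x).
Proof.
move=> F0; rewrite mxE fct_sumE big_add1 /=.
rewrite (big_nat_widen 0 j.+1 k.+1) ?ltn_ord //= big_mkord [in RHS]big_mkcond /=.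
(* Below the diagonal the matrix entry is the zero map, so the term is the value of [F i.+1] at
   [0]. *)
by apply: eq_bigr => i _; rewrite !mxE ltnS /=; case: ifP => // _; exact: F0.
Qed.

Theorem lemma2 (R : realType) (s : scalar_kind)
    (B Bbar : lmodType (scalars R s)) (L : nat -> {linear B -> Bbar})
    (L_neq0 : exists i x, L i x <> 0)
    (D : rec_data B Bbar) (HD : is_recursion L D) (k : nat) :
  oprow_mul (\row_(i < k.+1) (L i : B -> Bbar)) (upper_opmx (Mop D) k) =
    oprow_mul (\row_(i < k.+1) Sbar D i.+1) (upper_opmx (Eop D) k) /\
  oprow_mul (\row_(i < k.+1) Sbar D i.+1) (upper_opmx (Eop D) k) =
    \row_(i < k.+1) Sop D i.+1.
Proof.
(* The predecessor aligns [L], indexed from 0, with rows indexed from 1. *)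
have HL (j : 'I_k.+1) x := oprow_mul_upperE (F := fun i => L i.-1) (Mop D) j x
  (fun i _ => raddf0 (L i.-1)).
have Sbar0 i : (1 <= i)%N -> Sbar D i 0 = 0.
  by case/(operators_zmod_morphism HD) => /zmod_morphism0.
have HS (j : 'I_k.+1) x := oprow_mul_upperE (Eop D) j x Sbar0.
split; apply/rowP => j; apply/funext => x.
  by rewrite HL HS (sum_L_Mop HD).
by rewrite HS mxE (sum_Sbar_Eop HD).
Qed.
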